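(* Let $n_1\le n_2$ and let $\bar X,\bar Y\in\mathbb{R}^{n_1\times n_2}$ with $\bar Y\in\partial\|\bar X\|_*$. Then the subdifferential mapping $\partial\|\cdot\|_*$ has relative approximations around $(\bar X,\bar Y)$ by the set $$\mathcal{M}_*=\{Y\in\mathbb{R}^{n_1\times n_2}:\sigma_1(Y)=\dots=\sigma_p(Y)=1\},$$ where $p=p(\bar Y)$ is the number of singular values of $\bar Y$ equal to $1$.
   Context: $\|X\|_*$ is the nuclear norm (sum of the singular values), $\sigma_1(X)\ge\dots\ge\sigma_{n_1}(X)$ are the singular values of $X$ in nonincreasing order, and $\partial$ is the convex subdifferential. Relative approximations: for a proper lower semicontinuous convex function $g$ with $(\bar x,\bar y)\in\mathrm{gph}\,\partial g$ and a set $\mathcal{M}$ containing $\bar y$, $\partial g$ has relative approximations by $\mathcal{M}$ around $(\bar x,\bar y)$ if there exists $\varepsilon\in(0,1)$ such that for any $(x,y)\in\mathrm{gph}\,\partial g\cap\mathbb{B}_\varepsilon(\bar x,\bar y)$ (open ball) there exist $\lambda\in(1-\varepsilon,1]$, $\hat y\in\partial g(x)\cap\mathcal{M}$ and $\tilde y\in\partial g(x)$ satisfying $\lambda\hat y+(1-\lambda)\tilde y=y$. *)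

(* Defs.v *)
From HB Require Import structures.
From mathcomp Require Import all_boot all_order all_algebra.
From mathcomp Require Import polyrcf.
From mathcomp Require Import all_classical all_reals all_analysis.

Set Implicit Arguments.
Unset Strict Implicit.
Unset Printing Implicit Defensive.

Import Order.TTheory GRing.Theory Num.Theory.
Import numFieldNormedType.Exports.

Local Open Scope classical_set_scope.
Local Open Scope ring_scope.

Section ConvexAnalysis.
Context {R : realType} {m n : nat}.
Implicit Types (g : 'M[R]_(m, n) -> \bar R) (M : set 'M[R]_(m, n)).
Implicit Types X Y : 'M[R]_(m, n).

(* The Frobenius structure; the norm that the library puts on matrices is the
   maximum norm, which is equivalent but does not give the same balls. *)
Definition frobenius_dot X Y : R := \tr (X^T *m Y).

Definition frobenius_norm X : R := Num.sqrt (frobenius_dot X X).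

Definition proper_fun g : Prop :=
  (exists X, g X \is a fin_num) /\ (forall X, g X != -oo%E).

Definition convex_fun g : Prop :=
  forall X Y (t : R), 0 <= t <= 1 ->
    (g (t *: X + (1 - t) *: Y)%R <= t%:E * g X + (1 - t)%:E * g Y)%E.

Definition subdifferential g X : set 'M[R]_(m, n) :=
  [set V | g X \is a fin_num /\
           forall Z, (g X + (frobenius_dot V (Z - X)%R)%:E <= g Z)%E].

(* Open ball of the product space for the product Euclidean norm. *)
Definition pair_ball Xb Yb (e : R) : set ('M[R]_(m, n) * 'M[R]_(m, n)) :=
  [set P | Num.sqrt (frobenius_norm (P.1 - Xb) ^+ 2
                     + frobenius_norm (P.2 - Yb) ^+ 2) < e].

(* The first five fields are the standing requirements under which the notion
   is defined; the approximation property itself is the last one. *)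
Record relative_approximations g M Xb Yb : Prop := RelativeApproximations {
  ra_proper : proper_fun g ;
  ra_lsc : lower_semicontinuous g ;
  ra_convex : convex_fun g ;
  ra_graph : subdifferential g Xb Yb ;
  ra_mem : M Yb ;
  ra_approx : exists e : R, 0 < e < 1 /\
    forall X Y, subdifferential g X Y -> pair_ball Xb Yb e (X, Y) ->
      exists (l : R) (Yh Yt : 'M[R]_(m, n)),
        [/\ 1 - e < l <= 1,
            subdifferential g X Yh /\ M Yh,
            subdifferential g X Yt
          & l *: Yh + (1 - l) *: Yt = Y] }.

End ConvexAnalysis.

Section SingularValues.
Context {R : realType}.

(* [rootsR p] lists each real root of [p] once. *)
Definition roots_mult (p : {poly R}) : seq R :=
  flatten [seq nseq (mup x p) x | x <- rootsR p].

Context {m n : nat}.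
Implicit Types X Y : 'M[R]_(m, n).

(* Square roots of the eigenvalues of the [m] x [m] matrix [X X^T]. There are
   [m] of them, which is the usual list when [m <= n]. *)
Definition singular_values X : seq R :=
  sort >=%R [seq Num.sqrt a | a <- roots_mult (char_poly (X *m X^T))].

(* Indices start at 0: [sigma i X] is the (i+1)-st largest singular value. *)
Definition sigma (i : nat) X : R := (singular_values X)`_i.

Definition nuclear_norm X : R := \sum_(s <- singular_values X) s.

Definition num_unit_sv X : nat := count_mem 1 (singular_values X).

Definition unit_sv_set (p : nat) : set 'M[R]_(m, n) :=
  [set Y | forall i : nat, (i < p)%N -> sigma i Y = 1].

End SingularValues.

Lemma count_roots_mult (R : realType) (p : {poly R}) (x : R) :
  p != 0 -> count_mem x (roots_mult p) = mup x p.
Proof.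
move=> p0; rewrite /roots_mult count_flatten -map_comp.
have -> : [seq (count_mem x \o (fun y => nseq (mup y p) y)) y | y <- rootsR p]
   = [seq ((y == x) * mup x p)%N | y <- rootsR p].
  by apply: eq_map => y /=; rewrite count_nseq /=; case: eqP => [->|].
have [xr|xr] := boolP (x \in rootsR p); last first.
  rewrite mupNroot; last by move: xr; rewrite -(roots_on_rootsR p0) /=.
  by rewrite (eq_map (g := fun=> 0%N)) ?sumnE ?big_map ?big1 // => y; rewrite muln0.
have ur : uniq (rootsR p) by apply: uniq_roots.
rewrite sumnE big_map (bigD1_seq x) //= eqxx mul1n big1 ?addn0 // => y.
by move=> /negPf ->.
Qed.

Lemma singular_valuesE (R : realType) (m n : nat) (X : 'M[R]_(m, n))
    (s : seq R) :
  sorted >=%R s -> all (fun a => 0 <= a) s ->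
  char_poly (X *m X^T) = \prod_(a <- s) ('X - (a ^+ 2)%:P) ->
  singular_values X = s.
Proof.
move=> ss s0 cE; rewrite /singular_values.
have pm : perm_eq (roots_mult (char_poly (X *m X^T))) [seq a ^+ 2 | a <- s].
  apply/allP => x _ /=; rewrite count_roots_mult ?monic_neq0 ?char_poly_monic //.
  have -> : char_poly (X *m X^T) = \prod_(b <- [seq a ^+ 2 | a <- s]) ('X - b%:P).
    by rewrite big_map.
  by rewrite mu_prod_XsubC.
have ge_tr : transitive (>=%R : rel R) by move=> a b c /= ab bc; apply: le_trans ab.
have ge_anti : antisymmetric (>=%R : rel R).
  by move=> a b /= h; apply/le_anti; rewrite andbC.
have ge_tot : total (>=%R : rel R) by move=> a b; exact: le_total.
apply: (sorted_eq ge_tr ge_anti) => //; first exact: sort_sorted.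
rewrite perm_sort.
apply: (perm_trans (perm_map _ pm)); rewrite -map_comp.
suff -> : [seq (Num.sqrt \o (fun b => b ^+ 2)) a | a <- s] = s by [].
rewrite -[RHS]map_id; apply/eq_in_map => a /(allP s0) a0 /=.
by rewrite sqrtr_sqr ger0_norm.
Qed.

(* Main.v *)
Require Import Defs.
From mathcomp Require Import all_boot all_order all_algebra.
From mathcomp Require Import complex ring lra.
From mathcomp Require Import all_classical all_reals all_analysis.

(** Diagonalize [Y *m Y^T] by an orthogonal matrix [U]: the rows of [U *m Y]
    are then pairwise orthogonal, and their lengths [s_i] are the singular
    values of [Y].  Multiplying the [i]-th of these rows by a scalar [c_i]
    and rotating back by [U^T] gives [rescale U c Y], whose singular values
    are the [`|c_i| * s_i].  This frame replaces the singular value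
    decomposition: the right singular vectors are never normalized, so a
    vanishing singular value needs no special treatment.

    The nuclear norm is the support function of the unit ball of the operator
    norm ([frobenius_dot_le_nuclear_norm], [nuclear_norm_attained]).  Hence it
    is convex and lower semicontinuous, and [Y] is a subgradient at [X] exactly
    when [Y] is nonexpansive and [<Y, X>] equals the nuclear norm of [X]
    ([subdifferential_nuclear_norm]).  If moreover [s_i < 1], then the [i]-th
    row of [U *m Y] may be lengthened or shortened a little without leaving the
    unit ball, and since [Y] maximizes [<_, X>] there, that row is orthogonal to
    the [i]-th row of [U *m X].  Rescaling the rows with [s_i < 1] arbitrarily
    inside the unit ball therefore stays in the subdifferential at [X]
    ([subdifferential_rescale]).

    Let [Y] be a subgradient at [X] at distance less than [1/2] from [Yb].  By
    a dimension count, at least as many singular values of [Y] are [>= 1/2] as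
    singular values of [Yb] are [1] ([unit_singular_values_perturb]).  The
    matrix [Yh] is [Y] with these singular values raised to [1].  With weight
    [l = 3/4], the equation [l * Yh + (1 - l) * Yt = Y] forces [Yt] to have
    [4 s_i - 3] in place of such an [s_i], and [1/2 <= s_i <= 1] says exactly
    that this number lies in [[-1, 1]].  So [Yt] is a subgradient as well. *)

Set Implicit Arguments.
Unset Strict Implicit.
Unset Printing Implicit Defensive.

Import Order.TTheory GRing.Theory Num.Theory.
Import numFieldNormedType.Exports.

Local Open Scope classical_set_scope.
Local Open Scope ring_scope.

(** * Orthogonal diagonalization of real symmetric matrices *)

Section Spectral.
Variable R : rcfType.

Lemma char_poly_conj (F : fieldType) n (U A : 'M[F]_n) :
  U \in unitmx -> char_poly (U *m A *m invmx U) = char_poly A.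
Proof.
move=> Uu; rewrite /char_poly /char_poly_mx.
have PU : map_mx polyC U *m map_mx polyC (invmx U) = 1%:M.
  by rewrite -map_mxM mulmxV // map_mx1.
have -> : 'X%:M - map_mx polyC (U *m A *m invmx U) =
  map_mx polyC U *m ('X%:M - map_mx polyC A) *m map_mx polyC (invmx U).
  by rewrite mulmxBr mulmxBl !map_mxM scalar_mxC -[_%:M *m _ *m _]mulmxA PU mulmx1.
by rewrite !det_mulmx mulrAC -det_mulmx PU det1 mul1r.
Qed.

(** Over [R[i]] the matrix becomes hermitian, so its spectrum is real; a real
    root of the characteristic polynomial has an eigenvector over [R]. *)
Lemma symmetric_eigenvector n (A : 'M[R]_n.+1) : A^T = A ->
  exists a (v : 'rV_n.+1), v != 0 /\ v *m A = a *: v.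
Proof.
move=> As; pose AC := map_mx (real_complex R) A.
have Ah : AC \is hermsymmx.
  apply/is_hermitianmxP; rewrite expr0 scale1r /AC -[in LHS]As.
  by apply/matrixP => i j; rewrite !mxE; exact/esym/conjc_real.
have /mxOverP/(_ 0 0) := hermitian_spectral_diag_real Ah.
have /orthomx_spectralP := hermitian_normalmx Ah.
have := spectral_unit AC.
set P := spectralmx AC; set D := spectral_diag AC => Pu AE Dr.
have PA : P *m AC = diag_mx D *m P by rewrite AE -mulmxA mulKVmx.
have [a Da] : exists a, D 0 0 = real_complex R a.
  exact/complex_realP.
have : eigenvalue AC (D 0 0).
  apply/eigenvalueP; exists (row 0 P).
    by rewrite -row_mul PA row_mul row_diag_mx -scalemxAl -rowE.
  apply: contraTneq Pu => P0; rewrite unitmxE (expand_det_row _ 0) big1 ?unitr0 //.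
  by move=> j _; move/rowP/(_ j): P0; rewrite !mxE => ->; rewrite mul0r.
rewrite Da eigenvalue_root_char -map_char_poly fmorph_root -eigenvalue_root_char.
by case/eigenvalueP => v vA v0; exists a, v.
Qed.

Lemma row_sqr_gt0 n (v : 'rV[R]_n) : v != 0 -> 0 < (v *m v^T) 0 0.
Proof.
have sq j : v 0 j * v^T j 0 = v 0 j ^+ 2 by rewrite mxE.
move=> v0; rewrite mxE (eq_bigr _ (fun j _ => sq j)) lt_def.
rewrite sumr_ge0 ?andbT => [|j _]; last exact: sqr_ge0.
apply: contraNneq v0 => /eqP; rewrite psumr_eq0 => [/allP h|j _]; last exact: sqr_ge0.
apply/eqP/rowP => j; have := h j (mem_index_enum j).
by rewrite sqrf_eq0 [RHS]mxE => /eqP.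
Qed.

(** The reflection exchanging [v] and the first basis vector, or the identity
    when the two agree. *)
Lemma householder n (v : 'rV[R]_n.+1) : v *m v^T = 1%:M ->
  exists H : 'M[R]_n.+1, H *m H^T = 1%:M /\ row 0 H = v.
Proof.
move=> vv; pose e : 'rV[R]_n.+1 := delta_mx 0 0.
have ee : e *m e^T = 1%:M.
  by rewrite trmx_delta mul_delta_mx; apply/matrixP=> i j; rewrite !ord1 !mxE.
have [ev|ev] := eqVneq v e.
  by exists 1%:M; rewrite trmx1 mulmx1 ev row1.
have [w wE] : exists w, w = v - e by exists (v - e).
pose c := 2 - 2 * v 0 0.
have ve : v *m e^T = (v 0 0)%:M.
  by rewrite trmx_delta -colE; apply/matrixP=> i j; rewrite !ord1 !mxE eqxx mulr1n.
have ev' : e *m v^T = (v 0 0)%:M by rewrite -(trmxK (e *m _)) trmx_mul trmxK ve tr_scalar_mx.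
have wwE : w *m w^T = c%:M.
  rewrite wE raddfB /= mulmxBl !mulmxBr vv ee ve ev' -!raddfB /=.
  by congr (_ %:M); rewrite /c; ring.
have c0 : c != 0.
  have := row_sqr_gt0 (v := w); rewrite {1}wE subr_eq0 => /(_ ev).
  by rewrite wwE mxE mulr1n => /gt_eqF ->.
have Ht : (1%:M - (2 / c) *: (w^T *m w))^T = 1%:M - (2 / c) *: (w^T *m w).
  by rewrite linearB linearZ /= trmx_mul trmxK tr_scalar_mx.
exists (1%:M - (2 / c) *: (w^T *m w)); split; first rewrite Ht.
  rewrite mulmxBl mul1mx mulmxBr mulmx1 -!scalemxAl -!scalemxAr.
  rewrite mulmxA -[w^T *m w *m w^T]mulmxA wwE mul_mx_scalar -!scalemxAl !scalerA.
  have -> : 2 / c * (2 / c * c) = 2 / c + 2 / c by field.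
  by rewrite scalerDl opprB addrK subrK.
rewrite rowE mulmxBr mulmx1 -scalemxAr mulmxA.
have -> : delta_mx 0 0 *m w^T = (v 0 0 - 1)%:M.
  by rewrite wE raddfB /= mulmxBr ev' ee -raddfB.
rewrite mul_scalar_mx scalerA.
have -> : 2 / c * (v 0 0 - 1) = -1 by rewrite /c in c0 *; field.
by rewrite scaleN1r opprK wE addrC subrK.
Qed.

(** Deflation: rotating a unit eigenvector to the first basis vector makes the
    matrix block diagonal, with a symmetric block of smaller size. *)
Theorem symmetric_diagonalization n (A : 'M[R]_n) : A^T = A ->
  exists (U : 'M[R]_n) (d : 'rV_n), U *m U^T = 1%:M /\ U *m A *m U^T = diag_mx d.
Proof.
elim: n A => [|n IH] A As.
  by exists 1%:M, 0; split; rewrite [LHS]flatmx0 [RHS]flatmx0.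
have [a [v [v0 vA]]] := symmetric_eigenvector As.
pose q := (v *m v^T) 0 0.
have q0 : 0 < q by exact: row_sqr_gt0.
pose u := (Num.sqrt q)^-1 *: v.
have uu : u *m u^T = 1%:M.
  rewrite linearZ /= -scalemxAl -scalemxAr scalerA [v *m _]mx11_scalar -/q.
  by rewrite scale_scalar_mx -invfM -expr2 sqr_sqrtr ?ltW // mulVf ?gt_eqF.
have uA : u *m A = a *: u by rewrite -scalemxAl vA !scalerA mulrC.
have [H [HH H0]] := householder uu.
have [B BE] : exists B : 'M[R]_(1 + n), B = H *m A *m H^T by exists (H *m A *m H^T).
have Bs : B^T = B by rewrite BE !trmx_mul trmxK As mulmxA.
have B0 : row 0 B = a *: delta_mx 0 0.
  by rewrite BE !row_mul H0 uA -scalemxAl -H0 -row_mul HH row1.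
have /IH [Q [d [QQ Qd]]] : (drsubmx B)^T = drsubmx B by rewrite trmx_drsub Bs.
have ulB : ulsubmx B = a%:M.
  apply/matrixP => i j; rewrite !ord1 !mxE eqxx mulr1n.
  have := congr1 (fun r : 'rV_n.+1 => r 0 0) B0; rewrite !mxE !eqxx mulr1 => <-.
  by congr (B _ _); apply/val_inj.
have urB : ursubmx B = 0.
  apply/matrixP => i j; rewrite !ord1 !mxE.
  have := congr1 (fun r : 'rV_n.+1 => r 0 (rshift 1 j)) B0; rewrite !mxE /= mulr0 => <-.
  by congr (B _ _); apply/val_inj.
have dlB : dlsubmx B = 0 by rewrite -[dlsubmx B]trmxK trmx_dlsub Bs urB trmx0.
pose K : 'M[R]_(1 + n) := block_mx 1%:M 0 0 Q.
have Kt : K^T = block_mx 1%:M 0 0 Q^T by rewrite tr_block_mx !trmx0 trmx1.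
have KK : K *m K^T = 1%:M.
  rewrite Kt mulmx_block !mulmx0 !mul0mx !mulmx1 !addr0 add0r QQ.
  by rewrite -scalar_mx_block.
have KBK : K *m B *m K^T = diag_mx (row_mx a%:M d).
  rewrite -[B]submxK ulB urB dlB Kt !mulmx_block.
  rewrite !mulmx0 !mul0mx !addr0 !add0r !mulmx1 !mul0mx !mul1mx Qd diag_mx_row.
  by congr (block_mx _ _ _ _); apply/matrixP => i j; rewrite !ord1 !mxE.
exists (K *m H : 'M[R]_n.+1), (row_mx a%:M d : 'rV_(1 + n)); split.
  by rewrite trmx_mul mulmxA -(mulmxA K) HH mulmx1; exact: KK.
by rewrite -KBK BE trmx_mul !mulmxA.
Qed.
End Spectral.

(** * The Frobenius inner product *)

Section FrobeniusDot.
Variable R : realType.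

Lemma frobenius_dotE m n (X Y : 'M[R]_(m, n)) :
  frobenius_dot X Y = \sum_i \sum_j X i j * Y i j.
Proof.
rewrite /frobenius_dot /mxtrace exchange_big /=; apply: eq_bigr => j _.
by rewrite mxE; apply: eq_bigr => i _; rewrite mxE.
Qed.

Lemma frobenius_dotC m n (X Y : 'M[R]_(m, n)) :
  frobenius_dot X Y = frobenius_dot Y X.
Proof.
rewrite !frobenius_dotE; apply: eq_bigr => i _.
by apply: eq_bigr => j _; rewrite mulrC.
Qed.

Lemma frobenius_dotDr m n (X Y Z : 'M[R]_(m, n)) :
  frobenius_dot X (Y + Z) = frobenius_dot X Y + frobenius_dot X Z.
Proof. by rewrite /frobenius_dot mulmxDr raddfD. Qed.

Lemma frobenius_dotZr m n (X Y : 'M[R]_(m, n)) a :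
  frobenius_dot X (a *: Y) = a * frobenius_dot X Y.
Proof. by rewrite /frobenius_dot -scalemxAr mxtraceZ. Qed.

Lemma frobenius_dotDl m n (X Y Z : 'M[R]_(m, n)) :
  frobenius_dot (Y + Z) X = frobenius_dot Y X + frobenius_dot Z X.
Proof. by rewrite !(frobenius_dotC _ X) frobenius_dotDr. Qed.

Lemma frobenius_dotZl m n (X Y : 'M[R]_(m, n)) a :
  frobenius_dot (a *: Y) X = a * frobenius_dot Y X.
Proof. by rewrite !(frobenius_dotC _ X) frobenius_dotZr. Qed.

Lemma frobenius_dot_ge0 m n (X : 'M[R]_(m, n)) : 0 <= frobenius_dot X X.
Proof.
rewrite frobenius_dotE sumr_ge0 // => i _; rewrite sumr_ge0 // => j _.
by rewrite -expr2 sqr_ge0.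
Qed.

Lemma frobenius_dot_eq0 m n (X : 'M[R]_(m, n)) :
  frobenius_dot X X = 0 -> X = 0.
Proof.
have ge0 i j : 0 <= X i j * X i j by rewrite -expr2 sqr_ge0.
rewrite frobenius_dotE => /eqP; rewrite psumr_eq0 => [/allP h|i _]; last first.
  by rewrite sumr_ge0.
apply/matrixP => i j; have := h i (mem_index_enum i).
rewrite psumr_eq0 // => /allP/(_ j (mem_index_enum j)).
by rewrite mulf_eq0 orbb mxE => /eqP.
Qed.

Lemma frobenius_dotMl m n p (A : 'M[R]_(p, m)) (X : 'M[R]_(m, n)) (Y : 'M[R]_(p, n)) :
  frobenius_dot (A *m X) Y = frobenius_dot X (A^T *m Y).
Proof. by rewrite /frobenius_dot trmx_mul mulmxA. Qed.

Lemma frobenius_dotMr m n p (B : 'M[R]_(n, p)) (X : 'M[R]_(m, n)) (Y : 'M[R]_(m, p)) :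
  frobenius_dot (X *m B) Y = frobenius_dot X (Y *m B^T).
Proof. by rewrite /frobenius_dot trmx_mul -mulmxA mxtrace_mulC mulmxA. Qed.

Lemma frobenius_dot_sum_rows m n (X Y : 'M[R]_(m, n)) :
  frobenius_dot X Y = \sum_i frobenius_dot (row i X) (row i Y).
Proof.
rewrite frobenius_dotE; apply: eq_bigr => i _.
by rewrite frobenius_dotE big_ord1; apply: eq_bigr => j _; rewrite !mxE.
Qed.

Lemma frobenius_dot_row_row m n p (X : 'M[R]_(m, n)) (Y : 'M[R]_(p, n)) i j :
  frobenius_dot (row i X) (row j Y) = (X *m Y^T) i j.
Proof.
by rewrite frobenius_dotE big_ord1 mxE; apply: eq_bigr => k _; rewrite !mxE.
Qed.

Lemma frobenius_dot_diag m n (c : 'rV[R]_m) (X Y : 'M[R]_(m, n)) :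
  frobenius_dot (diag_mx c *m X) Y =
  \sum_i c 0 i * frobenius_dot (row i X) (row i Y).
Proof.
rewrite frobenius_dot_sum_rows; apply: eq_bigr => i _.
by rewrite row_mul row_diag_mx -scalemxAl -rowE frobenius_dotZl.
Qed.

Lemma cauchy_schwarz m n (X Y : 'M[R]_(m, n)) :
  frobenius_dot X Y ^+ 2 <= frobenius_dot X X * frobenius_dot Y Y.
Proof.
have [Y0|Y0] := eqVneq (frobenius_dot Y Y) 0.
  by rewrite (frobenius_dot_eq0 Y0) -(scale0r 0) !frobenius_dotZr !mul0r mulr0 expr0n.
have Yp : 0 < frobenius_dot Y Y by rewrite lt_def Y0 frobenius_dot_ge0.
rewrite -subr_ge0 -(pmulr_rge0 _ Yp).
set z := frobenius_dot Y Y *: X + (- frobenius_dot X Y) *: Y.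
have -> : frobenius_dot Y Y * (frobenius_dot X X * frobenius_dot Y Y - frobenius_dot X Y ^+ 2)
   = frobenius_dot z z; last exact: frobenius_dot_ge0.
rewrite /z !(frobenius_dotDl, frobenius_dotDr, frobenius_dotZl, frobenius_dotZr).
by rewrite (frobenius_dotC Y X); ring.
Qed.

(** The operator norm is at most the Frobenius norm: Cauchy-Schwarz in each
    column. *)
Lemma frobenius_dot_mul_le m n (w : 'rV[R]_m) (X : 'M[R]_(m, n)) :
  frobenius_dot (w *m X) (w *m X) <= frobenius_dot w w * frobenius_dot X X.
Proof.
rewrite {1}/frobenius_dot mxtrace_mulC /mxtrace big_ord1 mxE.
have -> : frobenius_dot X X = \sum_j frobenius_dot (row j X^T) (row j X^T).
  rewrite -frobenius_dot_sum_rows !frobenius_dotE exchange_big; apply: eq_bigr => j _.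
  by apply: eq_bigr => i _; rewrite !mxE.
rewrite mulr_sumr; apply: ler_sum => j _.
rewrite [_^T _ _]mxE -expr2; apply: le_trans (cauchy_schwarz _ _).
have -> // : (w *m X) 0 j = frobenius_dot w (row j X^T).
by rewrite frobenius_dotE big_ord1 mxE; apply: eq_bigr => i _; rewrite !mxE.
Qed.

(** From [2|Y|^2 + 2|Y - X|^2 - |X|^2 = |2Y - X|^2]; it plays the part of the
    triangle inequality without square roots. *)
Lemma frobenius_dot_le_double m n (X Y : 'M[R]_(m, n)) :
  frobenius_dot X X <= 2 * frobenius_dot Y Y + 2 * frobenius_dot (Y - X) (Y - X).
Proof.
have := frobenius_dot_ge0 (Y + (Y - X)); rewrite -scaleN1r.
rewrite !(frobenius_dotDl, frobenius_dotDr, frobenius_dotZl, frobenius_dotZr).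
by rewrite (frobenius_dotC Y X) => h; lra.
Qed.

Lemma frobenius_dot_continuous m n (X : 'M[R]_(m, n)) :
  continuous (frobenius_dot X : 'M[R]_(m, n) -> R).
Proof.
rewrite (_ : frobenius_dot X = fun Z => \sum_i \sum_j X i j * Z i j); last first.
  by apply/funext => Z; rewrite frobenius_dotE.
apply: continuous_big => [|i _]; first exact: add_continuous.
apply: continuous_big => [|j _]; first exact: add_continuous.
move=> Z; have FZ : Filter (nbhs Z) := nbhs_filter Z.
exact: (cvgM (cvg_cst (X i j)) (coord_continuous (i := i) (j := j) (x := Z))).
Qed.
End FrobeniusDot.

(** * Singular frames and the dual description of the nuclear norm *)

Section Frames.
Variables (R : realType) (m n : nat).
Implicit Types (X Y Z : 'M[R]_(m, n)) (U : 'M[R]_m) (s c : 'rV[R]_m).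

(** A singular value decomposition of [X] whose right singular vectors are not
    normalized: the [i]-th row of [U *m X] is [s_i] times the [i]-th one. *)
Definition singular_frame U s X : Prop :=
  [/\ U *m U^T = 1%:M, forall i, 0 <= s 0 i
    & (U *m X) *m (U *m X)^T = diag_mx (\row_i s 0 i ^+ 2)].

Definition rescale U c X : 'M[R]_(m, n) := U^T *m (diag_mx c *m (U *m X)).

Lemma singular_frame_exists X : exists U s, singular_frame U s X.
Proof.
have [|U [d [UU UA]]] := @symmetric_diagonalization R m (X *m X^T).
  by rewrite trmx_mul trmxK.
have dE : (U *m X) *m (U *m X)^T = diag_mx d by rewrite -UA trmx_mul !mulmxA.
have d_ge0 i : 0 <= d 0 i.
  have <- : (U *m X *m (U *m X)^T) i i = d 0 i by rewrite dE mxE eqxx mulr1n.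
  by rewrite -frobenius_dot_row_row frobenius_dot_ge0.
exists U, (\row_i Num.sqrt (d 0 i)); split => // [i|]; first by rewrite mxE sqrtr_ge0.
by rewrite dE; congr diag_mx; apply/rowP => i; rewrite !mxE sqr_sqrtr.
Qed.

Lemma perm_singular_values U s X : singular_frame U s X ->
  perm_eq (singular_values X) [seq s 0 i | i <- enum 'I_m].
Proof.
case=> UU s0 UX.
suff -> : singular_values X = sort >=%R [seq s 0 i | i <- enum 'I_m].
  by rewrite perm_sort.
apply: singular_valuesE.
- by apply: sort_sorted => x y /=; exact: le_total.
- by rewrite all_sort; apply/allP => _ /mapP [i _ ->].
have Uu : U \in unitmx by case: (mulmx1_unit UU).
(* The characteristic polynomial does not see the change of basis. *)
have iU : invmx U = U^T by rewrite -[LHS]mulmx1 -UU mulKmx.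
rewrite -(char_poly_conj _ Uu) iU.
have -> : U *m (X *m X^T) *m U^T = diag_mx (\row_i s 0 i ^+ 2).
  by rewrite -UX trmx_mul !mulmxA.
rewrite char_poly_trig ?diag_mx_is_trig // (perm_big [seq s 0 i | i <- enum 'I_m]) /=; last first.
  by rewrite perm_sort.
rewrite big_map big_enum; apply: eq_bigr => i _.
by rewrite !mxE eqxx mulr1n.
Qed.

Lemma nuclear_norm_frame U s X : singular_frame U s X ->
  nuclear_norm X = \sum_i s 0 i.
Proof.
by move/perm_singular_values/(perm_big _) => pe; rewrite /nuclear_norm pe big_map big_enum.
Qed.

Lemma num_unit_sv_frame U s X : singular_frame U s X ->
  num_unit_sv X = #|[pred i | s 0 i == 1]|.
Proof.
move/perm_singular_values/permP => pe.
by rewrite /num_unit_sv pe count_map -sum1_count big_enum_cond sum1_card.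
Qed.

Lemma frobenius_dot_frame U s X i j : singular_frame U s X ->
  frobenius_dot (row i (U *m X)) (row j (U *m X)) = (s 0 i ^+ 2) *+ (i == j).
Proof. by case=> _ _ UX; rewrite frobenius_dot_row_row UX !mxE. Qed.

Lemma frobenius_dot_orthogonal p U (X Y : 'M[R]_(m, p)) : U *m U^T = 1%:M ->
  frobenius_dot (U *m X) (U *m Y) = frobenius_dot X Y.
Proof. by move/mulmx1C => UU; rewrite frobenius_dotMl mulmxA UU mul1mx. Qed.

Lemma frobenius_dot_rescale U c X Y :
  frobenius_dot (rescale U c X) Y =
  \sum_i c 0 i * frobenius_dot (row i (U *m X)) (row i (U *m Y)).
Proof. by rewrite frobenius_dotMl trmxK frobenius_dot_diag. Qed.

Lemma singular_frame_rescale U s c X : singular_frame U s X ->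
  singular_frame U (\row_i (`|c 0 i| * s 0 i)) (rescale U c X).
Proof.
case=> UU s0 UX; split => // [i|]; first by rewrite mxE mulr_ge0.
rewrite /rescale; move: (U *m X) UX => V VV.
rewrite mulmxA UU mul1mx trmx_mul tr_diag_mx mulmxA -(mulmxA _ V) VV.
rewrite !mulmx_diag; congr diag_mx; apply/rowP => i; rewrite !mxE.
by rewrite exprMn real_normK ?num_real //; ring.
Qed.

Lemma rescaleD U c c' (a b : R) X :
  a *: rescale U c X + b *: rescale U c' X = rescale U (a *: c + b *: c') X.
Proof.
rewrite /rescale; move: (U *m X) => V.
by rewrite linearD !linearZ /= mulmxDl mulmxDr -!scalemxAl -!scalemxAr.

Qed.

Lemma rescale1 U X : U *m U^T = 1%:M -> rescale U (const_mx 1) X = X.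
Proof. by move/mulmx1C => UU; rewrite /rescale diag_const_mx mul1mx mulmxA UU mul1mx. Qed.

Definition nonexpansive Y : Prop :=
  forall w : 'rV[R]_m, frobenius_dot (w *m Y) (w *m Y) <= frobenius_dot w w.

Lemma frobenius_dot_mul_frame U s Y (w : 'rV[R]_m) : singular_frame U s Y ->
  frobenius_dot (w *m Y) (w *m Y) = \sum_i (w *m U^T) 0 i ^+ 2 * s 0 i ^+ 2.
Proof.
case=> UU _ UY.
have -> : w *m Y = w *m U^T *m (U *m Y) by rewrite -mulmxA (mulmxA U^T) (mulmx1C UU) mul1mx.
rewrite frobenius_dotMr -mulmxA UY frobenius_dotC frobenius_dotE big_ord1.
by apply: eq_bigr => i _; rewrite mul_mx_diag !mxE; ring.
Qed.

Lemma frobenius_dot_row_orthogonal U (w : 'rV[R]_m) : U *m U^T = 1%:M ->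
  frobenius_dot w w = \sum_i (w *m U^T) 0 i ^+ 2.
Proof.
move/mulmx1C => UU; transitivity (frobenius_dot (w *m U^T) (w *m U^T)).
  by rewrite frobenius_dotMr -mulmxA trmxK UU mulmx1.
by rewrite frobenius_dotE big_ord1; apply: eq_bigr => i _; rewrite expr2.
Qed.

Lemma nonexpansive_frame U s Y : singular_frame U s Y ->
  nonexpansive Y <-> forall i, s 0 i <= 1.
Proof.
move=> F; have [UU s0 _] := F; split => [cY i|s1 w].
  have := cY (row i U); rewrite -row_mul (frobenius_dot_frame _ _ F) eqxx.
  by rewrite frobenius_dot_row_row UU !mxE eqxx expr_le1.
rewrite (frobenius_dot_mul_frame _ F) (frobenius_dot_row_orthogonal _ UU).
apply: ler_sum => i _; rewrite ler_piMr ?sqr_ge0 //.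
by rewrite expr_le1.
Qed.

(** In a frame of [X], the rows of [U *m Y] have length at most [1] and those of
    [U *m X] have length [s_i]: apply Cauchy-Schwarz row by row. *)
Lemma frobenius_dot_le_nuclear_norm X Y : nonexpansive Y ->
  frobenius_dot Y X <= nuclear_norm X.
Proof.
move=> cY; have [U [s F]] := singular_frame_exists X; have [UU s0 _] := F.
rewrite (nuclear_norm_frame F) -(frobenius_dot_orthogonal _ _ UU) frobenius_dot_sum_rows.
apply: ler_sum => i _; apply: le_trans (ler_norm _) _.
rewrite -(@ler_pXn2r _ 2) ?nnegrE // real_normK ?num_real //.
apply: le_trans (cauchy_schwarz _ _) _.
rewrite (frobenius_dot_frame _ _ F) eqxx mulr1n ler_piMl ?sqr_ge0 // row_mul.
apply: le_trans (cY _) _.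
by rewrite frobenius_dot_row_row UU !mxE eqxx.
Qed.

(** The maximizer is the polar factor of [X], whose singular values are [1] or
    [0]; the convention [0^-1 = 0] takes care of the kernel. *)
Lemma nuclear_norm_attained X :
  exists2 Y, nonexpansive Y & frobenius_dot Y X = nuclear_norm X.
Proof.
have [U [s F]] := singular_frame_exists X; have [UU s0 _] := F.
exists (rescale U (\row_i (s 0 i)^-1) X).
  apply/(nonexpansive_frame (singular_frame_rescale _ F)) => i; rewrite !mxE.
  rewrite ger0_norm ?invr_ge0 //.
  by have [->|si] := eqVneq (s 0 i) 0; rewrite ?mulr0 ?mulVf.
rewrite frobenius_dot_rescale (nuclear_norm_frame F); apply: eq_bigr => i _.
rewrite (frobenius_dot_frame _ _ F) eqxx mulr1n mxE.
by have [->|si] := eqVneq (s 0 i) 0; rewrite ?expr0n ?mulr0 // expr2 mulKf.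
Qed.

Lemma nuclear_normZ (a : R) X : 0 <= a ->
  nuclear_norm (a *: X) <= a * nuclear_norm X.
Proof.
move=> a0; have [Y cY <-] := nuclear_norm_attained (a *: X).
by rewrite frobenius_dotZr ler_wpM2l // frobenius_dot_le_nuclear_norm.
Qed.

Lemma nuclear_normD X Y : nuclear_norm (X + Y) <= nuclear_norm X + nuclear_norm Y.
Proof.
have [Z cZ <-] := nuclear_norm_attained (X + Y).
by rewrite frobenius_dotDr lerD // frobenius_dot_le_nuclear_norm.
Qed.

(** The characterization valid for every support function.  That a subgradient
    [Y] is nonexpansive is seen by testing it against [Y] with all its singular
    values but one replaced by [0]: this gives [s_i ^ 2 <= s_i]. *)
Lemma subdifferential_nuclear_norm X Y :
  subdifferential (fun X => (nuclear_norm X)%:E) X Y <->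
  nonexpansive Y /\ frobenius_dot Y X = nuclear_norm X.
Proof.
split=> [[_ sub]|[cY YX]]; last first.
  split=> // Z; rewrite -EFinD lee_fin frobenius_dotDr -scaleN1r frobenius_dotZr YX.
  by have := frobenius_dot_le_nuclear_norm Z cY; lra.
have {}sub Z : nuclear_norm X + frobenius_dot Y Z <= nuclear_norm (X + Z).
  by have := sub (X + Z); rewrite -EFinD lee_fin addrAC subrr add0r.
split; last first.
  apply: le_anti; apply/andP; split.
    have := sub X; have := nuclear_normD X X; lra.
  have := sub (- X); rewrite -scaleN1r frobenius_dotZr scaleN1r subrr.
  have := @nuclear_normZ 0 X (lexx 0); rewrite scale0r; lra.
have {}sub Z : frobenius_dot Y Z <= nuclear_norm Z.
  by have := sub Z; have := nuclear_normD X Z; lra.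
have [U [s F]] := singular_frame_exists Y; have [UU s0 _] := F.
apply/(nonexpansive_frame F) => i.
have := sub (rescale U (delta_mx 0 i) Y).
rewrite frobenius_dotC frobenius_dot_rescale (nuclear_norm_frame (singular_frame_rescale _ F)).
rewrite (bigD1 i) //= big1 => [|j ji]; last by rewrite mxE (negPf ji) mul0r.
rewrite (bigD1 i) //= [in leRHS]big1 => [|j ji]; last by rewrite !mxE (negPf ji) normr0 mul0r.
rewrite !mxE !eqxx (frobenius_dot_frame _ _ F) eqxx normr1 !addr0 !mul1r mulr1n.
have := s0 i; rewrite le_eqVlt => /predU1P[<- //|si].
by rewrite expr2 -[leRHS]mul1r ler_pM2r.
Qed.

(** Complementary slackness: as [s_i < 1], the [i]-th row of [U *m Y] can be
    multiplied by [1 + d] for small [d] of either sign without leaving the unit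
    ball, where [Y] already maximizes [<_, X>]. *)
Lemma frobenius_dot_row_eq0 X Y U s i : singular_frame U s Y -> nonexpansive Y ->
  frobenius_dot Y X = nuclear_norm X -> s 0 i < 1 ->
  frobenius_dot (row i (U *m Y)) (row i (U *m X)) = 0.
Proof.
move=> F cY YX si; have [UU s0 _] := F.
have s1 := (nonexpansive_frame F).1 cY.
set t := frobenius_dot _ _.
have perturb (d : R) : `|d| <= 1 - s 0 i -> d * t <= 0.
  move=> dle.
  pose c : 'rV[R]_m := 1 *: const_mx 1 + d *: delta_mx 0 i.
  have cc : nonexpansive (rescale U c Y).
    apply/(nonexpansive_frame (singular_frame_rescale _ F)) => j; rewrite !mxE.
    have [->|ji] := eqVneq j i; last by rewrite mulr0 addr0 mulr1 normr1 mul1r.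
    rewrite !mulr1; apply: le_trans (_ : (1 + `|d|) * s 0 i <= _).
      by rewrite ler_wpM2r // (le_trans (ler_normD _ _)) // normr1.
    have := ler_piMr (normr_ge0 d) (s1 i); rewrite mulrDl mul1r; lra.
  have := frobenius_dot_le_nuclear_norm X cc.
  rewrite -YX /c -rescaleD rescale1 // scale1r frobenius_dotDl frobenius_dotZl.
  rewrite frobenius_dot_rescale (bigD1 i) //= big1 => [|j ji]; last first.
    by rewrite mxE (negPf ji) mul0r.
  by rewrite mxE !eqxx mul1r addr0 gerDl.
have d0 : 0 < 1 - s 0 i by rewrite subr_gt0.
have := perturb (1 - s 0 i); have := perturb (- (1 - s 0 i)).
rewrite normrN gtr0_norm // => /(_ (lexx _)) h1 /(_ (lexx _)) h2.
apply: le_anti; rewrite -(pmulr_rle0 _ d0) h2 /=.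
by rewrite -(pmulr_rge0 _ d0) -oppr_le0 -mulNr.
Qed.
End Frames.

(** * Perturbation of singular values and relative approximations *)

Lemma nth_sorted_max (R : realType) (s : seq R) (a : R) i :
  sorted >=%R s -> all (<= a) s -> (i < count_mem a s)%N -> s`_i = a.
Proof.
elim: s i => [|x s IH] //= i xs /andP[xa sa].
have [->|xNa] := eqVneq x a; last first.
  rewrite add0n => /(leq_ltn_trans (leq0n i)); rewrite -has_count => /hasP[y ys /eqP ya].
  have ge_tr : transitive (>=%R : rel R) by move=> b c d /= bc cd; apply: le_trans bc.
  have /allP/(_ y ys) /= := order_path_min ge_tr xs; rewrite ya => ax.
  by move/eqP: xNa; case; apply/le_anti; rewrite xa.
case: i => [|i] //=; rewrite add1n ltnS => /IH -> //.
exact: path_sorted xs.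
Qed.

(** There are more unknowns (the coordinates in [J]) than linear conditions (one
    for each element of [P]). *)
Lemma row_vanishing_on (F : fieldType) n (J P : {pred 'I_n}) (M : 'M[F]_n) :
  (#|P| < #|J|)%N ->
  exists z : 'rV_n, [/\ z != 0, {in [predC J], forall j, z 0 j = 0}
                      & {in P, forall i, (z *m M) 0 i = 0}].
Proof.
move=> PJ.
pose f (a : 'I_#|J|) : 'I_n := enum_val a; pose g (b : 'I_#|P|) : 'I_n := enum_val b.
have /rowV0Pn[z /sub_kermxP zK z0] : kermx (mxsub f g M) != 0.
  rewrite -mxrank_eq0 mxrank_ker subn_eq0 -ltnNge.
  exact: leq_ltn_trans (rank_leq_col _) PJ.
have zE j : (z *m rowsub f 1%:M) 0 j = \sum_a z 0 a * (f a == j)%:R.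
  by rewrite mxE; apply: eq_bigr => a _; rewrite !mxE.
exists (z *m rowsub f 1%:M); split.
- apply: contraNneq z0 => zS; apply/eqP/rowP => a.
  have := zE (f a); rewrite zS (bigD1 a) //= eqxx mulr1 big1 => [|b ba]; last first.
    by rewrite (inj_eq enum_val_inj) (negPf ba) mulr0.
  by rewrite addr0 !mxE => <-.
- move=> j jJ; rewrite zE big1 // => a _.
  by case: eqP => [fa|]; rewrite ?mulr0 //; move: jJ; rewrite inE -fa /f enum_valP.
move=> i iP; rewrite -mulmxA mul_rowsub_mx mul1mx.
have := congr1 (fun r : 'rV_#|P| => r 0 (enum_rank_in iP i)) zK.
rewrite [RHS]mxE => <-; rewrite !mxE; apply: eq_bigr => a _.
by rewrite ![_ a _]mxE /g enum_rankK_in.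
Qed.

Section Perturbation.
Variables (R : realType) (m n : nat).
Implicit Types (X Y Z : 'M[R]_(m, n)) (U : 'M[R]_m) (s c : 'rV[R]_m).

Lemma unit_sv_set_frame U s Y p : singular_frame U s Y -> nonexpansive Y ->
  (p <= #|[pred i | (s 0 i == 1)%R]|)%N -> unit_sv_set p Y.
Proof.
move=> F cY pc i ip; rewrite /sigma; apply: nth_sorted_max.
- by apply: sort_sorted => x y; exact: le_total.
- rewrite (perm_all _ (perm_singular_values F)); apply/allP => _ /mapP[j _ ->] /=.
  exact: (nonexpansive_frame F).1.
rewrite -[count_mem 1 _]/(num_unit_sv Y) (num_unit_sv_frame F).
exact: leq_trans pc.
Qed.

(** If there were fewer, some [w != 0] would lie both in the span of the left
    singular vectors of [Yb] for the value [1] and in that of the left singular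
    vectors of [Y] for values below [1/2].  Then [|w Yb| = |w|], while
    [|w Y| <= |w| / 2] and [|w (Y - Yb)| < |w| / 2]. *)
Lemma unit_singular_values_perturb Ub sb Yb U s Y :
  singular_frame Ub sb Yb -> singular_frame U s Y ->
  frobenius_dot (Y - Yb) (Y - Yb) < 1 / 4 ->
  (#|[pred i | (sb 0 i == 1)%R]| <= #|[pred i | (1 / 2 <= s 0 i)%R]|)%N.
Proof.
move=> Fb F YYb; rewrite leqNgt; apply/negP => /row_vanishing_on.
move=> /(_ _ (Ub *m U^T)) [z [z0 zJ zP]].
have [UUb sb0 _] := Fb; have [UU s0 _] := F.
(* [z] is supported where [sb = 1], and the coordinates of [w] in the frame of
   [Y] vanish where [s >= 1/2]. *)
pose w := z *m Ub.
have wUb : w *m Ub^T = z by rewrite -mulmxA UUb mulmx1.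
have wU : w *m U^T = z *m (Ub *m U^T) by rewrite mulmxA.
have w_gt0 : 0 < frobenius_dot w w.
  rewrite lt_def frobenius_dot_ge0 andbT; apply: contraNneq z0 => /frobenius_dot_eq0 w0.
  by rewrite -wUb w0 mul0mx.
have wYb : frobenius_dot (w *m Yb) (w *m Yb) = frobenius_dot w w.
  rewrite (frobenius_dot_mul_frame _ Fb) (frobenius_dot_row_orthogonal _ UUb) wUb.
  apply: eq_bigr => j _; have [->|sj] := eqVneq (sb 0 j) 1; first by rewrite expr1n mulr1.
  by rewrite zJ ?inE // expr0n mul0r.
have wY : frobenius_dot (w *m Y) (w *m Y) <= 1 / 4 * frobenius_dot w w.
  rewrite (frobenius_dot_mul_frame _ F) (frobenius_dot_row_orthogonal _ UU) mulr_sumr.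
  apply: ler_sum => i _; rewrite wU [leRHS]mulrC.
  have [si|si] := lerP (1 / 2) (s 0 i).
    by rewrite zP ?inE // expr0n !mul0r.
  apply: ler_wpM2l; first exact: sqr_ge0.
  by have := s0 i; nra.
have := frobenius_dot_mul_le w (Y - Yb); rewrite mulmxBr => wYYb.
have := frobenius_dot_le_double (w *m Yb) (w *m Y); rewrite wYb => h.
have : frobenius_dot w w * frobenius_dot (Y - Yb) (Y - Yb) < frobenius_dot w w * (1 / 4).
  by rewrite ltr_pM2l.
lra.
Qed.

(** The rows that are changed contribute [0] to [<Y, X>], by complementary
    slackness. *)
Lemma subdifferential_rescale X Y U s c : singular_frame U s Y ->
  subdifferential (fun X => (nuclear_norm X)%:E) X Y ->
  (forall i, `|c 0 i| * s 0 i <= 1) -> (forall i, s 0 i = 1 -> c 0 i = 1) ->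
  subdifferential (fun X => (nuclear_norm X)%:E) X (rescale U c Y).
Proof.
move=> F /subdifferential_nuclear_norm[cY YX] cs c1; have [UU s0 _] := F.
apply/subdifferential_nuclear_norm; split.
  by apply/(nonexpansive_frame (singular_frame_rescale _ F)) => i; rewrite mxE.
rewrite -YX -[in RHS](rescale1 Y UU) !frobenius_dot_rescale; apply: eq_bigr => i _.
rewrite [in RHS]mxE; have := (nonexpansive_frame F).1 cY i.
rewrite le_eqVlt => /predU1P[/c1 -> //|si].
by rewrite (frobenius_dot_row_eq0 F cY YX si) !mulr0.
Qed.

(** A supremum of continuous functions; the maximizer at [X] gives the
    neighbourhood. *)
Lemma nuclear_norm_lower_semicontinuous :
  lower_semicontinuous (fun X : 'M[R]_(m, n) => (nuclear_norm X)%:E).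
Proof.
move=> X a; rewrite lte_fin => aX.
have [Y cY YX] := nuclear_norm_attained X; rewrite -YX in aX.
exists [set Z | a < frobenius_dot Y Z].
  exact: (@frobenius_dot_continuous R m n Y X _ (lt_nbhsr aX)).
by move=> Z /= aZ; rewrite lte_fin (lt_le_trans aZ) // frobenius_dot_le_nuclear_norm.
Qed.

Lemma nuclear_norm_convex : convex_fun (fun X : 'M[R]_(m, n) => (nuclear_norm X)%:E).
Proof.
move=> X Y t /andP[t0 t1]; rewrite -!EFinM -EFinD lee_fin.
apply: le_trans (nuclear_normD _ _) _.
by apply: lerD; apply: nuclear_normZ; rewrite // subr_ge0.
Qed.

End Perturbation.

Theorem proposition4p4 (R : realType) (n1 n2 : nat) (hn : (n1 <= n2)%N)
  (Xb Yb : 'M[R]_(n1, n2))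
  (hY : subdifferential (fun X : 'M[R]_(n1, n2) => (nuclear_norm X)%:E) Xb Yb) :
  relative_approximations (fun X : 'M[R]_(n1, n2) => (nuclear_norm X)%:E)
    (unit_sv_set (num_unit_sv Yb)) Xb Yb.
Proof.
have [Ub [sb Fb]] := singular_frame_exists Yb.
have [cYb _] := (subdifferential_nuclear_norm _ _).1 hY.
split => //.
- by split => //; exists 0.
- exact: nuclear_norm_lower_semicontinuous.
- exact: nuclear_norm_convex.
- by apply: (unit_sv_set_frame Fb cYb); rewrite (num_unit_sv_frame Fb).
exists (1 / 2); split; first by lra.
move=> X Y sY; rewrite /pair_ball /= => XYe.
have YYb : frobenius_dot (Y - Yb) (Y - Yb) < 1 / 4.
  have : frobenius_norm (X - Xb) ^+ 2 + frobenius_norm (Y - Yb) ^+ 2 < (1 / 2) ^+ 2.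
    have pos : 0 <= frobenius_norm (X - Xb) ^+ 2 + frobenius_norm (Y - Yb) ^+ 2.
      by rewrite addr_ge0 ?sqr_ge0.
    rewrite -(sqr_sqrtr pos) ltr_pXn2r ?nnegrE ?sqrtr_ge0 //; lra.
  rewrite /frobenius_norm !sqr_sqrtr ?frobenius_dot_ge0 //.
  have -> : (1 / 2 : R) ^+ 2 = 1 / 4 by field.
  by apply: le_lt_trans; rewrite lerDr frobenius_dot_ge0.
have [U [s F]] := singular_frame_exists Y; have [UU s0 _] := F.
have [cY _] := (subdifferential_nuclear_norm _ _).1 sY.
have s1 := (nonexpansive_frame F).1 cY.
(* The factors of [Yh] and [Yt]: they send [s_i >= 1/2] to [1] and to
   [4 s_i - 3]. *)
pose ch := \row_i (if 1 / 2 <= s 0 i then (s 0 i)^-1 else 1).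
pose ct := \row_i (if 1 / 2 <= s 0 i then 4 - 3 / s 0 i else 1).
have chs i : `|ch 0 i| * s 0 i = if 1 / 2 <= s 0 i then 1 else s 0 i.
  rewrite mxE; case: ifP => si; last by rewrite normr1 mul1r.
  have sp : 0 < s 0 i by lra.
  by rewrite gtr0_norm ?invr_gt0 // mulVf ?gt_eqF.
have sh : subdifferential (fun X => (nuclear_norm X)%:E) X (rescale U ch Y).
  apply: (subdifferential_rescale F sY) => i; first by rewrite chs; case: ifP.
  by rewrite mxE => ->; rewrite invr1 if_same.
exists (3 / 4), (rescale U ch Y), (rescale U ct Y); split; first by lra.
- split => //.
  apply: (unit_sv_set_frame (singular_frame_rescale ch F)).
    by case/subdifferential_nuclear_norm: sh.
  rewrite (num_unit_sv_frame Fb).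
  apply: leq_trans (unit_singular_values_perturb Fb F YYb) _.
  by apply: subset_leq_card; apply/fintype.subsetP => i; rewrite !inE mxE chs => ->.
- apply: (subdifferential_rescale F sY) => i; rewrite mxE; last first.
    by move=> ->; rewrite divr1; case: ifP => // _; lra.
  case: ifP => si; last by rewrite normr1 mul1r.
  have sp : 0 < s 0 i by lra.
  rewrite -{2}(gtr0_norm sp) -normrM mulrBl divfK ?gt_eqF // ler_norml.
  by have := s1 i; lra.
rewrite rescaleD -[RHS](rescale1 Y UU); congr rescale; apply/rowP => i.
rewrite !mxE; case: ifP => si; last by lra.
have sp : s 0 i != 0 by apply: lt0r_neq0; lra.
by field.
Qed.
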